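(* Let $M_1,\dots,M_n$ ($n\ge 2$) be DFAs over a common alphabet $\Sigma$ and let $G$ be the deterministic labeled graph constructed from them as described in the context. A word $u\in(\Sigma\cup\{\lhd,\rhd\})^*$ is synchronizing for $G$ if and only if there exist $v\in(\Sigma\cup\{\rhd\})^*$, an integer $k\ge 1$, and $w\in\bigcap_{i=1}^n L(M_i)$ such that $u=v\lhd w\rhd^k$.
   Context: A DFA $M_i$ has a finite state set $Q_i$ (the $Q_i$ pairwise disjoint), total transition function $\delta_i\colon Q_i\times\Sigma\to Q_i$ (viewed as edges $q\to\delta_i(q,a)$ labeled $a$), initial state $s_i$, accepting set $F_i$; $L(M_i)=\{w\in\Sigma^*:\delta_i(s_i,w)\in F_i\}$. Let $\lhd,\rhd$ be distinct symbols not in $\Sigma$. $G$: add a vertex $t$ with a self loop labeled $\rhd$; for each $i=1,\dots,n$, add vertices $p_i$ and $r_i$, self loops labeled $\rhd$ on $p_i$ and on $r_i$, a self loop labeled $a$ on $p_i$ for each $a\in\Sigma$, embed $M_i$, add an edge labeled $\lhd$ from $p_i$ to $s_i$, for each $q\in F_i$ an edge labeled $\rhd$ from $q$ to $t$, and for each $q\in Q_i\setminus F_i$ an edge labeled $\rhd$ from $q$ to $r_i$. For this deterministic labeled graph (no vertex has two outgoing edges with the same label), $q\cdot u$ denotes the end vertex of the unique path from $q$ labeled $u$ (if it exists), $Q_G\cdot u$ is the set of all such end vertices over all vertices $q$, and $u$ is synchronizing for $G$ if $|Q_G\cdot u|=1$. *)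

(* Defs.v *)
From HB Require Import structures.
From mathcomp Require Import all_boot.
Set Implicit Arguments.
Unset Strict Implicit.
Unset Printing Implicit Defensive.

Record dfa (Sigma : finType) := DFA {
  state : finType;
  trans : state -> Sigma -> state;
  init : state;
  accept : {set state}
}.

Definition lang (Sigma : finType) (M : dfa Sigma) : pred (seq Sigma) :=
  [pred w | foldl (@trans _ M) (init M) w \in accept M].

Record dlgraph (A : finType) := DLGraph {
  vert : finType;
  edge : vert -> A -> vert -> bool;
  edge_det : forall x a y z, edge x a y -> edge x a z -> y = z
}.

Section Graph.
Variables (A : finType) (G : dlgraph A).
Implicit Types (x y z : vert G) (u : seq A).

Fixpoint lpath x u y : bool :=
  if u is a :: u' then [exists z, edge x a z && lpath z u' y] else x == y.

Lemma lpath_det u x y z : lpath x u y -> lpath x u z -> y = z.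
Proof.
elim: u x => [|a u IHu] x /=; first by move=> /eqP<- /eqP.
case/existsP=> x1 /andP[e1 p1] /existsP[x2 /andP[e2 p2]].
by rewrite (edge_det e2 e1) in p2; apply: IHu p1 p2.
Qed.

(* x . u; by [lpath_det] the choice made by [pick] is forced. *)
Definition dot x u : option (vert G) := [pick y | lpath x u y].

Definition dotset u : {set vert G} := [set y | [exists x, dot x u == Some y]].

Definition synchronizing u : Prop := #|dotset u| = 1.

End Graph.

(* The alphabet Sigma extended with two fresh distinct symbols:
   [Lmark] is the left triangle, [Rmark] the right triangle. *)
Inductive letter (Sigma : Type) := Sym of Sigma | Lmark | Rmark.
Arguments Lmark {Sigma}.
Arguments Rmark {Sigma}.

Section LetterFin.
Variable Sigma : finType.

Definition letter_code (l : letter Sigma) : Sigma + bool :=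
  match l with Sym a => inl a | Lmark => inr false | Rmark => inr true end.

Definition letter_decode (c : Sigma + bool) : letter Sigma :=
  match c with inl a => Sym a | inr false => Lmark | inr true => Rmark end.

Lemma letter_codeK : cancel letter_code letter_decode.
Proof. by case. Qed.

HB.instance Definition _ := Countable.copy (letter Sigma) (can_type letter_codeK).
HB.instance Definition _ : isFinite (letter Sigma) := CanIsFinite letter_codeK.

End LetterFin.

Section Construction.
Variables (Sigma : finType) (n : nat) (M : 'I_n -> dfa Sigma).

(* The index carried by [VQ] makes the embedded state sets pairwise disjoint. *)
Inductive vertex :=
  | VT
  | VP of 'I_n
  | VR of 'I_n
  | VQ (i : 'I_n) of state (M i).

Definition vertex_code (x : vertex) :
    option ('I_n + 'I_n + {i : 'I_n & state (M i)}) :=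
  match x with
  | VT => None
  | VP i => Some (inl (inl i))
  | VR i => Some (inl (inr i))
  | VQ i q => Some (inr (Tagged (fun j => state (M j)) q))
  end.

Definition vertex_decode
    (c : option ('I_n + 'I_n + {i : 'I_n & state (M i)})) : vertex :=
  match c with
  | None => VT
  | Some (inl (inl i)) => VP i
  | Some (inl (inr i)) => VR i
  | Some (inr q) => VQ (tagged q)
  end.

Lemma vertex_codeK : cancel vertex_code vertex_decode.
Proof. by case. Qed.

HB.instance Definition _ := Countable.copy vertex (can_type vertex_codeK).
HB.instance Definition _ : isFinite vertex := CanIsFinite vertex_codeK.

Definition sync_edge (x : vertex) (l : letter Sigma) (y : vertex) : bool :=
  match x, l with
  | VT, Rmark => y == VT
  | VP i, Rmark => y == VP i
  | VP i, Sym _ => y == VP i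
  | VP i, Lmark => y == VQ (init (M i))
  | VR i, Rmark => y == VR i
  | VQ i q, Sym a => y == VQ (trans q a)
  | VQ i q, Rmark => y == if q \in accept (M i) then VT else VR i
  | _, _ => false
  end.

Lemma sync_edge_det x l y z : sync_edge x l y -> sync_edge x l z -> y = z.
Proof. by case: x l => [|i|i|i q] [a||] //= /eqP-> /eqP->. Qed.

Definition sync_graph : dlgraph (letter Sigma) := DLGraph sync_edge_det.

End Construction.

(* Main.v *)
(** The mark [Lmark] can only be read at some [p_i], and a word without [Lmark]
    fixes every [p_i]; so, as [n >= 2], a word without [Lmark] is not
    synchronizing, and a prefix ending with the first [Lmark] sends the vertex
    set onto the initial states.  From these a word labels a path only if it has
    the form [w Rmark^k], and the end vertex then still remembers the index
    [i], unless [k > 0] and [M_i] accepts [w], in which case it is [t]. *)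
Require Import Defs.
From HB Require Import structures.
From mathcomp Require Import all_boot.
Set Implicit Arguments.
Unset Strict Implicit.
Unset Printing Implicit Defensive.

Lemma split_first (T : eqType) (a : T) (s : seq T) :
  a \in s -> exists s1 s2, a \notin s1 /\ s = s1 ++ a :: s2.
Proof.
elim: s => // b s IHs; rewrite inE; case: eqVneq => [<- _|neq_ab /= /IHs].
  by exists [::], s.
by case=> s1 [s2 [s1'a ->]]; exists (b :: s1), s2; rewrite inE negb_or neq_ab.
Qed.

Section LabeledPaths.
Variables (A : finType) (G : dlgraph A).
Implicit Types (x y z : vert G) (u v : seq A).

Lemma lpath_cons x a z u y : edge x a z -> lpath x (a :: u) y = lpath z u y.
Proof.
move=> xz /=; apply/existsP/idP => [[z' /andP[xz']]|zy].
  by rewrite (edge_det xz' xz).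
by exists z; rewrite xz.
Qed.

Lemma lpath_cat x u v y :
  lpath x (u ++ v) y = [exists z, lpath x u z && lpath z v y].
Proof.
elim: u x => [|a u IHu] x /=.
  by apply/idP/existsP => [xy|[z /andP[/eqP->]]//]; exists x; rewrite eqxx.
apply/existsP/existsP => [[x1 /andP[e1]]|[z /andP[/existsP[x1 /andP[e1 p1]] p2]]].
  rewrite IHu => /existsP[z /andP[p1 p2]]; exists z; rewrite p2 andbT.
  by apply/existsP; exists x1; rewrite e1.
by exists x1; rewrite e1 IHu; apply/existsP; exists z; rewrite p1.
Qed.

Lemma mem_dotset u y : (y \in dotset G u) = [exists x, lpath x u y].
Proof.
rewrite inE; apply/eq_existsb => x; rewrite /dot.
case: pickP => [z xz|no_path]; last by rewrite no_path.
by apply/eqP/idP => [[<-]//|xy]; rewrite (lpath_det xz xy).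
Qed.

(** Restates the cardinality condition through [lpath] alone, so that neither [pick] nor [dotset]
    occurs afterwards. *)
Lemma synchronizingP u :
  synchronizing G u <->
  exists y, (exists x, lpath x u y) /\ forall x z, lpath x u z -> z = y.
Proof.
split=> [/eqP/cards1P[y def_y]|[y [[x xy] uniq_y]]].
  exists y; split=> [|x z xz].
    by apply/existsP; rewrite -mem_dotset def_y set11.
  by apply/set1P; rewrite -def_y mem_dotset; apply/existsP; exists x.
apply/eqP/cards1P; exists y; apply/setP=> z; rewrite mem_dotset inE.
apply/existsP/eqP => [[x' /uniq_y]//|->]; by exists x.
Qed.

End LabeledPaths.

Section SyncGraph.
Variables (Sigma : finType) (n : nat) (M : 'I_n -> dfa Sigma).
Implicit Types (u v : seq (letter Sigma)) (w : seq Sigma) (i : 'I_n).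

Local Notation G := (sync_graph M).
Local Notation VT := (VT M).
Local Notation VP := (VP M).
Local Notation VR := (VR M).

Definition sink (x : vertex M) : bool :=
  match x with Defs.VT | Defs.VR _ => true | _ => false end.

Lemma lpath_VP i v : Lmark \notin v -> @lpath _ G (VP i) v (VP i).
Proof.
elim: v => [|a v IHv]; first by rewrite /= eqxx.
rewrite inE negb_or => /andP[a_neq /IHv pv].
by rewrite (@lpath_cons _ G _ _ (VP i)) //=; case: a a_neq => //=.
Qed.

Lemma lpath_Lmark (x : vertex M) u y :
  @lpath _ G x (Lmark :: u) y ->
  exists2 i, x = VP i & @lpath _ G (VQ (init (M i))) u y.
Proof.
by case: x => [|i|i|i q] /existsP[z /andP[//= /eqP->]]; exists i.
Qed.

(** The only edge leaving a sink is its [Rmark] loop. *)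
Lemma lpath_sink (x y : vertex M) u :
  sink x -> @lpath _ G x u y = (u == nseq (size u) Rmark) && (y == x).
Proof.
move=> sx; elim: u => [|a u IHu]; first by rewrite /= eq_sym.
case: (eqVneq a Rmark) => [->|a_neq].
  rewrite (@lpath_cons _ G _ _ x) ?IHu ?eqseq_cons ?eqxx //.
  by case: x sx {IHu} => //= *; rewrite eqxx.
rewrite [size _]/= [nseq _ _]/= eqseq_cons (negPf a_neq).
by apply/existsP => -[z]; case: x a sx a_neq {IHu} => [|i|i|i q] [].
Qed.

(** The end of the path from [q] labeled by [w] and then [k] copies of [Rmark]. The first [Rmark]
    leads to a sink and the others loop there, so only whether [k] is 0 matters. *)
Definition final_vertex i (q : state (M i)) w k : vertex M :=
  let q' := foldl (@trans _ (M i)) q w in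
  if k is 0 then VQ q' else if q' \in accept (M i) then VT else VR i.

Lemma lpath_VQ i (q : state (M i)) w k (y : vertex M) :
  @lpath _ G (VQ q) (map (@Sym Sigma) w ++ nseq k Rmark) y =
  (y == final_vertex q w k).
Proof.
elim: w q => [|a w IHw] q; last first.
  by rewrite (@lpath_cons _ G _ _ (VQ (trans q a))) ?IHw //=.
case: k => [|k]; first by rewrite /= eq_sym.
(* The witness is the sink entered by the first [Rmark]. *)
rewrite (@lpath_cons _ G _ _ (final_vertex q [::] k.+1)) //=.
by rewrite lpath_sink ?size_nseq ?eqxx //; case: ifP.
Qed.

(** No state has an outgoing [Lmark] edge, and after the first [Rmark] the path is caught in a
    sink. *)
Lemma lpath_VQ_word i (q : state (M i)) u (y : vertex M) :
  @lpath _ G (VQ q) u y ->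
  exists w k, u = map (@Sym Sigma) w ++ nseq k Rmark.
Proof.
elim: u q => [|a u IHu] q; first by exists [::], 0.
case: a => [a||]; last 1 first.
- rewrite (@lpath_cons _ G _ _ (final_vertex q [::] 1)) //=.
  rewrite lpath_sink; last by case: ifP.
  by case/andP=> /eqP-> _; exists [::], (size u).+1.
- rewrite (@lpath_cons _ G _ _ (VQ (trans q a))) //=.
  by case/IHu=> w [k ->]; exists (a :: w), k.
by case/existsP.
Qed.

(** [VQ] and [VR] carry the index of the automaton, so runs in two different automata can only meet
    in [VT]. *)
Lemma final_vertex_eq i j (qi : state (M i)) (qj : state (M j)) w k :
  i != j -> final_vertex qi w k = final_vertex qj w k ->
  0 < k /\ foldl (@trans _ (M i)) qi w \in accept (M i).
Proof.
rewrite /final_vertex; case: k => [|k] neq_ij.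
  by case=> eq_ij; rewrite eq_ij eqxx in neq_ij.
case: ifP => // _; case: ifP => // _ [eq_ij].
by rewrite eq_ij eqxx in neq_ij.
Qed.

End SyncGraph.

Theorem theorem4p20 (Sigma : finType) (n : nat) (hn : 2 <= n)
    (M : 'I_n -> dfa Sigma) (u : seq (letter Sigma)) :
  @synchronizing (letter Sigma) (sync_graph M) u <->
  exists (v : seq (letter Sigma)) (k : nat) (w : seq Sigma),
    [/\ Lmark \notin v,
        1 <= k,
        (forall i : 'I_n, w \in lang (M i)) &
        u = v ++ [:: Lmark] ++ map (@Sym Sigma) w ++ nseq k Rmark].
Proof.
pose i0 : 'I_n := Ordinal (ltnW hn).
have other (i : 'I_n) : exists j, i != j.
  have /card_gt0P[j] : 0 < #|predC1 i|.
    by rewrite cardC1 card_ord -ltnS prednK // ltnW.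
  by rewrite !inE eq_sym; exists j.
have lpath_p v u' i y : Lmark \notin v ->
    @lpath _ (sync_graph M) (VQ (init (M i))) u' y ->
    @lpath _ (sync_graph M) (VP M i) (v ++ Lmark :: u') y.
  move=> v'L qy; rewrite lpath_cat; apply/existsP; exists (VP M i).
  by rewrite lpath_VP // (@lpath_cons _ (sync_graph M) _ _ (VQ (init (M i)))) /=.
apply: (iff_trans (@synchronizingP _ (sync_graph M) u)); split=> [[y [[x xy] uniq_y]]|[v [k [w [v'L k_gt0 wL ->]]]]].
  (* Without [Lmark], the loops at two distinct vertices [VP] give two distinct end vertices. *)
  have [uL|u'L] := boolP (Lmark \in u); last first.
    have [j /eqP[]] := other i0.
    have /uniq_y ei := lpath_VP M i0 u'L; have /uniq_y := lpath_VP M j u'L.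
    by rewrite -ei => -[].
  have [v [u' [v'L def_u]]] := split_first uL.
  (* The one path known to exist fixes the shape of [u'], since it reads [u'] from an initial
     state. *)
  move: xy; rewrite {1}def_u lpath_cat => /existsP[z /andP[_]].
  case/lpath_Lmark=> i _ /lpath_VQ_word[w [k def_u']].
  (* As [v] avoids [Lmark], every [VP j] can read all of [u], not only the start of the given
     path. *)
  have end_y j : final_vertex (init (M j)) w k = y.
    apply: (uniq_y (VP M j)); rewrite def_u; apply: lpath_p => //.
    by rewrite def_u' lpath_VQ.
  have accepts j : 0 < k /\ w \in lang (M j).
    have [j' neq_jj'] := other j.
    by apply: (final_vertex_eq neq_jj'); rewrite !end_y.
  exists v, k, w; split=> //; first by case: (accepts i).
    by move=> j; case: (accepts j).
  by rewrite def_u def_u'.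
have end_t i : final_vertex (init (M i)) w k = VT M.
  by case: k k_gt0 => // k _; have := wL i; rewrite inE /final_vertex => ->.
exists (VT M); split.
  by exists (VP M i0); apply: lpath_p => //; rewrite lpath_VQ end_t.
(* Wherever [v] leads from [x], reading [Lmark] next forces the path into some initial state. *)
move=> x z; rewrite lpath_cat => /existsP[z' /andP[_ /lpath_Lmark[i _]]].
by rewrite lpath_VQ end_t => /eqP.
Qed.
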